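(* Let $R\subset\Omega$ be inducible, bounded away from the origin, such that $y>0$ for every $(x,y)\in R$ and $s_R(z)=1$ for every $z\in R$. Then the map $\tau_R:\Omega_R\to\Omega_R$ satisfies $\tau_R(0,Y)=(0,Y)$ and, for $X\neq0$, \[\tau_R(X,Y)=\left(\frac{\alpha_R(z)}{X}-\beta_R(z),\ \frac{1}{\beta_R(z)+\alpha_R(z)Y}\right),\qquad z=\varphi_R^{-1}(X,Y),\] and the measure $\bar\nu_R$ has density $\dfrac{1}{\bar\mu(R)(1+XY)^2}$.
   Context: Write $\Omega=[0,1]^2$; $M\cdot z=\frac{az+b}{cz+d}$ for invertible $M=\begin{pmatrix}a&b\\c&d\end{pmatrix}$. Let $\varepsilon(x)=0$ if $x\le1/2$, $1$ if $x>1/2$; $A_0=\begin{pmatrix}1&0\\1&1\end{pmatrix}$, $A_1=\begin{pmatrix}0&1\\1&1\end{pmatrix}$; Farey tent map $F(x)=A_{\varepsilon(x)}^{-1}\cdot x$; $\varepsilon_n(x)=\varepsilon(F^{n-1}(x))$. Ito's natural extension $\mathcal{F}(x,y)=(A_{\varepsilon(x)}^{-1}\cdot x,A_{\varepsilon(x)}\cdot y)$ on $\Omega$ (a.e. invertible), preserving $\bar\mu$ with density $1/(x+y-xy)^2$. $R$ measurable is inducible if $0<\bar\mu(R)<\infty$ or $R=\Omega$; $N_R(z)=\inf\{n\ge1:\mathcal{F}^n(z)\in R\}$; $\mathcal{F}_R=\mathcal{F}^{N_R}$; induced system $(R,\mathcal{B},\bar\mu_R,\mathcal{F}_R)$ with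 $\bar\mu_R=\bar\mu|_R/\bar\mu(R)$. $A_R(z)=A_{\varepsilon_1(x)}\cdots A_{\varepsilon_{N_R(z)}(x)}=\begin{pmatrix}u_R(z)&t_R(z)\\ s_R(z)&r_R(z)\end{pmatrix}$ for $z=(x,y)$ (under the hypotheses, $u_R(z)\in\{0,1\}$). $\mathcal{F}_R^{-1}(z)$ denotes, when it exists, $\mathcal{F}^{-n}(z)$ for the least $n\ge1$ with $\mathcal{F}^{-n}(z)\in R$; $d_R(z)=s_R(\mathcal{F}_R^{-1}(z))$ if defined, else $1$; $\alpha_R(z)=-\det(A_R(z))d_R(z)s_R(\mathcal{F}_R(z))$; $\beta_R(z)=s_R(z)u_R(\mathcal{F}_R(z))+r_R(z)s_R(\mathcal{F}_R(z))$. Define $\varphi_R:R\to\mathbb{R}^2$ by $\varphi_R(x,y)=(x,(1-y)/y)$ if $u_R(x,y)=0$ and $\varphi_R(x,y)=(x-1,1-y)$ if $u_R(x,y)=1$ (injective off a null set), $\Omega_R=\varphi_R(R)$, $\tau_R(0,Y)=(0,Y)$ and $\tau_R=\varphi_R\circ\mathcal{F}_R\circ\varphi_R^{-1}$ for $X\ne0$, and $\bar\nu_R=\bar\mu_R\circ\varphi_R^{-1}$. *)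

(* Defs.v *)
From HB Require Import structures.
From mathcomp Require Import all_boot all_order all_algebra.
From mathcomp Require Import all_classical all_reals all_analysis.
Set Implicit Arguments.
Unset Strict Implicit.
Unset Printing Implicit Defensive.
Import Order.TTheory GRing.Theory Num.Theory.
Import numFieldNormedType.Exports.
Local Open Scope classical_set_scope.
Local Open Scope ring_scope.

(* The real line is an arbitrary K : realType; R always denotes the region on
   which Ito's natural extension is induced. *)

Definition lebesgue2 (K : realType) :
    {measure set (measurableTypeR K * measurableTypeR K) -> \bar K} :=
  (@lebesgue_measure K \x @lebesgue_measure K)%E.

Definition Omega (K : realType) : set (K * K) :=
  [set z | 0 <= z.1 <= 1 /\ 0 <= z.2 <= 1].

Definition mx2 (K : realType) (a b c d : K) : 'M[K]_2 :=
  \matrix_(i < 2, j < 2)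
    (if i == 0 then (if j == 0 then a else b) else (if j == 0 then c else d)).

Definition mobius (K : realType) (M : 'M[K]_2) (z : K) : K :=
  (M 0 0 * z + M 0 1) / (M 1 0 * z + M 1 1).

Definition fareyA (K : realType) (e : bool) : 'M[K]_2 :=
  if e then mx2 0 1 1 1 else mx2 1 0 1 1.

Definition eps (K : realType) (x : K) : bool := 2^-1 < x.

Definition farey (K : realType) (x : K) : K :=
  mobius (invmx (fareyA K (eps x))) x.

Definition eps_ (K : realType) (n : nat) (x : K) : bool :=
  eps (iter n.-1 (@farey K) x).

Definition ito (K : realType) (z : K * K) : K * K :=
  (mobius (invmx (fareyA K (eps z.1))) z.1, mobius (fareyA K (eps z.1)) z.2).

Definition mubar (K : realType) (A : set (K * K)) : \bar K :=
  (\int[@lebesgue2 K]_(z in A `&` @Omega K)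
     (((z.1 + z.2 - z.1 * z.2) ^+ 2)^-1)%:E)%E.

Definition inducible (K : realType) (R : set (K * K)) : Prop :=
  [/\ measurable R, R `<=` @Omega K
    & ((0 < mubar R)%E /\ (mubar R < +oo)%E) \/ R = @Omega K].

Definition bounded_away_from_origin (K : realType) (R : set (K * K)) : Prop :=
  exists2 e : K, 0 < e & forall z, R z -> e <= `|z|.

(* Infimum of a set of naturals; None is the infimum +oo of the empty set. *)
Definition inf_nat (P : nat -> Prop) : option nat :=
  if pselect (exists n, `[< P n >]) is left h then Some (ex_minn h) else None.

Definition N_ (K : realType) (R : set (K * K)) (z : K * K) : option nat :=
  inf_nat (fun n => (1 <= n)%N /\ R (iter n (@ito K) z)).

(* The induced map is only meaningful where N_ R z is finite; it is completed
   by the identity. *)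
Definition F_ (K : realType) (R : set (K * K)) (z : K * K) : K * K :=
  if N_ R z is Some n then iter n (@ito K) z else z.

(* Points of R need not return to R: for R = [0,1] x [1/2,1], which yields the
   regular continued fractions, the points with x = 0 never do.  There A_ is
   given the value A_1, so that s_ = 1 and u_ = 0: the hypothesis s_ = 1 puts no
   constraint on such points, and those with x = 0 are sent by phi_ to the
   line X = 0. *)
Definition A_ (K : realType) (R : set (K * K)) (z : K * K) : 'M[K]_2 :=
  if N_ R z is Some n then \prod_(1 <= i < n.+1) fareyA K (eps_ i z.1)
  else fareyA K true.

Definition u_ (K : realType) (R : set (K * K)) (z : K * K) : K := A_ R z 0 0.
Definition t_ (K : realType) (R : set (K * K)) (z : K * K) : K := A_ R z 0 1.
Definition s_ (K : realType) (R : set (K * K)) (z : K * K) : K := A_ R z 1 0.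
Definition r_ (K : realType) (R : set (K * K)) (z : K * K) : K := A_ R z 1 1.

Definition preim_ito (K : realType) (R : set (K * K)) (n : nat) (z : K * K) :
  set (K * K) := [set w | R w /\ iter n (@ito K) w = z].

(* ito is injective on Omega only off the line y = 1, so that a point may have
   several n-fold preimages in R; one of them is chosen. *)
Definition Finv_ (K : realType) (R : set (K * K)) (z : K * K) :
  option (K * K) :=
  if inf_nat (fun n => (1 <= n)%N /\ preim_ito R n z !=set0) is Some n
  then Some (xget z (preim_ito R n z)) else None.

Definition d_ (K : realType) (R : set (K * K)) (z : K * K) : K :=
  if Finv_ R z is Some w then s_ R w else 1.

Definition alpha_ (K : realType) (R : set (K * K)) (z : K * K) : K :=
  - \det (A_ R z) * d_ R z * s_ R (F_ R z).

Definition beta_ (K : realType) (R : set (K * K)) (z : K * K) : K :=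
  s_ R z * u_ R (F_ R z) + r_ R z * s_ R (F_ R z).

(* When s_ = 1 on R, u_ takes only the values 0 and 1 on R. *)
Definition phi_ (K : realType) (R : set (K * K)) (z : K * K) : K * K :=
  if u_ R z == 0 then (z.1, (1 - z.2) / z.2) else (z.1 - 1, 1 - z.2).

Definition Omega_ (K : realType) (R : set (K * K)) : set (K * K) :=
  phi_ R @` R.

Definition phiinv_ (K : realType) (R : set (K * K)) (p : K * K) : K * K :=
  xget p [set z | R z /\ phi_ R z = p].

Definition tau_ (K : realType) (R : set (K * K)) (p : K * K) : K * K :=
  if p.1 == 0 then p else phi_ R (F_ R (phiinv_ R p)).

Definition mubar_ (K : realType) (R A : set (K * K)) : \bar K :=
  (((fine (mubar R))^-1)%:E * mubar (A `&` R))%E.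

Definition nubar_ (K : realType) (R : set (K * K)) : set (K * K) -> \bar K :=
  pushforward (mubar_ R) (phi_ R).

(* Main.v *)
Require Import Defs.
From HB Require Import structures.
From mathcomp Require Import all_boot all_order all_algebra.
From mathcomp Require Import all_classical all_reals all_analysis.
From mathcomp Require Import measurable_realfun ring lra zify.
Import Order.TTheory GRing.Theory Num.Theory.
Import numFieldNormedType.Exports.
Local Open Scope classical_set_scope.
Local Open Scope ring_scope.

(* Let M = (u, t; s, r) be the product of the Farey matrices along n steps of
   the orbit of (x, y), and (x', y') the n-th iterate.  Then x = M . x', and in
   the coordinate w = (1 - y) / y the second component obeys w' = M^T . w.  The
   entries of M are natural numbers with u <= s, t <= r and det M = 1 or -1, so
   s = 1 leaves only u = 0, t = 1, det M = -1 and u = 1, t = r - 1, det M = 1;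
   in both cases the formula for tau is a direct computation.  A point with
   u = 1 has x < 1, so the sign of X recovers u and phi is injective.

   For the density, R is cut into its parts u = 0 and u = 1.  On the first, phi
   is y |-> 1/y - 1 on each fibre, which carries dy / y^2 to dY; on the second
   it is an isometry.  In both charts dx dy / (x + y - xy)^2 becomes
   dX dY / (1 + XY)^2. *)

(** * Products of Farey matrices *)

Section mx2.
Variable K : realType.
Implicit Types (M : 'M[K]_2) (a b c d x : K).

Lemma mx2E a b c d :
  ((mx2 a b c d 0 0 = a) * (mx2 a b c d 0 1 = b) *
   (mx2 a b c d 1 0 = c) * (mx2 a b c d 1 1 = d))%type.
Proof. by rewrite !mxE. Qed.

Lemma mx2_eta M : M = mx2 (M 0 0) (M 0 1) (M 1 0) (M 1 1).
Proof.
by apply/matrixP => i j; rewrite mxE;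
  case: i => -[|[|//]] ?; case: j => -[|[|//]] ? /=;
  congr (M _ _); exact: val_inj.
Qed.

Lemma mul_mx2 a b c d a' b' c' d' : mx2 a b c d *m mx2 a' b' c' d' =
  mx2 (a * a' + b * c') (a * b' + b * d') (c * a' + d * c') (c * b' + d * d').
Proof.
by rewrite [LHS]mx2_eta !mxE !big_ord_recl !big_ord0 !mxE/= !addr0.
Qed.

Lemma mx2_scalar1 : mx2 1 0 0 1 = 1%:M :> 'M[K]_2.
Proof. by rewrite [RHS]mx2_eta !mxE. Qed.

Lemma det_mx2 M : \det M = M 0 0 * M 1 1 - M 0 1 * M 1 0.
Proof.
rewrite {1}[M]mx2_eta (expand_det_row _ 0) !big_ord_recl big_ord0 /cofactor.
by rewrite !det_mx11 !mxE/= expr0 mul1r expr1 mulN1r addr0 mulrN.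
Qed.

Lemma invmx_fareyA e :
  invmx (fareyA K e) = if e then mx2 (-1) 1 1 0 else mx2 1 0 (-1) 1.
Proof.
set B := (RHS).
have AB : B *m fareyA K e = 1%:M.
  by rewrite /B; case: e {B} => /=; rewrite mul_mx2 -mx2_scalar1; congr mx2; ring.
have [_ AU] := mulmx1_unit AB.
by rewrite -[LHS]mul1mx -AB -mulmxA mulmxV// mulmx1.
Qed.

End mx2.

(** * The Farey map and the orbits of the natural extension *)

Section farey.
Variable K : realType.
Implicit Types (x y : K) (z : K * K).

Lemma fareyE x : farey x = if eps x then (1 - x) / x else x / (1 - x).
Proof.
rewrite /farey invmx_fareyA /mobius; case: ifP => _; rewrite !mx2E.
  by congr (_ / _); ring.
by congr (_ / _); ring.
Qed.

Lemma itoE z :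
  ito z = (farey z.1, if eps z.1 then (1 + z.2)^-1 else z.2 / (1 + z.2)).
Proof.
rewrite /ito -/(farey _); congr (_, _); rewrite /mobius /fareyA.
by case: ifP => _; rewrite !mx2E ?mul0r ?add0r ?addr0 ?mul1r// [z.2 + _]addrC.
Qed.

Lemma iter_ito_fst n z : (iter n (@ito K) z).1 = iter n (@farey K) z.1.
Proof. by elim: n => [//|n IH]; rewrite !iterS itoE/= IH. Qed.

Lemma farey_itv x : 0 <= x <= 1 -> 0 <= farey x <= 1.
Proof.
move=> /andP[x0 x1]; rewrite fareyE /eps; case: ltP => xh.
  by rewrite divr_ge0 ?subr_ge0//= ler_pdivrMr; lra.
by rewrite divr_ge0 ?subr_ge0//= ler_pdivrMr; lra.
Qed.

(** The right-hand side is the Moebius action of [fareyA K (eps x)] on [farey x], the inverse branch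
    that leads back from an iterate to [x]. *)
Lemma fareyK x : 0 <= x <= 1 ->
  x = if eps x then (1 + farey x)^-1 else farey x / (1 + farey x).
Proof.
move=> /andP[x0 x1]; rewrite fareyE /eps; case: ltP => xh.
  by rewrite -{1}(divff (_ : x != 0)) ?gt_eqF//;
    [rewrite -mulrDl addrCA subrr addr0 mul1r invrK|lra].
by field; rewrite !gt_eqF; lra.
Qed.

(** This is the value of [A_ R z] for [x = z.1] when the return time is [n]; the i-th factor is
    chosen by the (i-1)-st iterate of [x]. *)
Definition farey_mx n x : 'M[K]_2 := \prod_(1 <= i < n.+1) fareyA K (eps_ i x).

Lemma farey_mxS n x :
  farey_mx n.+1 x = farey_mx n x *m fareyA K (eps (iter n (@farey K) x)).
Proof. by rewrite /farey_mx big_nat_recr// mulmxE. Qed.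

(* The bound a <= c fails for the empty product, the identity matrix. *)
Lemma farey_mx_nat n x : exists a b c d : nat,
  [/\ farey_mx n x = mx2 a%:R b%:R c%:R d%:R, (a <= c + (n == 0))%N, (b <= d)%N
    , (0 < d)%N & (a * d = b * c + 1 \/ b * c = a * d + 1)%N].
Proof.
elim: n => [|n [a [b [c [d [E ac bd d0 det]]]]]].
  exists 1%N, 0%N, 0%N, 1%N; split=> //; last by left.
  by rewrite /farey_mx big_nil mx2_scalar1.
(* For n = 0 only a <= c + 1 is available, so the identity matrix is kept as a separate case. Either
   alternative yields a + b <= c + d, which the new matrix needs besides b <= d. *)
have ac' : (a <= c \/ (a = 1 /\ b = 0 /\ c = 0 /\ d = 1))%N.
  move: ac E; case: n => [|n] /=; last by rewrite addn0; left.
  move=> _; rewrite /farey_mx big_nil -[1]mx2_scalar1 => E; right.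
  move: (congr1 (fun M : 'M[K]_2 => M 0 0) E) (congr1 (fun M : 'M[K]_2 => M 0 1) E)
    (congr1 (fun M : 'M[K]_2 => M 1 0) E) (congr1 (fun M : 'M[K]_2 => M 1 1) E).
  rewrite !mx2E => /esym/eqP + /esym/eqP + /esym/eqP + /esym/eqP.
  by rewrite !pnatr_eq1 !pnatr_eq0 => /eqP -> /eqP -> /eqP -> /eqP ->.
rewrite farey_mxS E; case: (eps _) => /=; rewrite mul_mx2.
  exists b, (a + b)%N, d, (c + d)%N; rewrite !mulr0 !mulr1 !add0r !natrD.
  by split=> //; nia.
exists (a + b)%N, b, (c + d)%N, d; rewrite !mulr0 !mulr1 !add0r !natrD.
by split=> //; nia.
Qed.

(* Conjugation by A_1 turns A_e into its transpose, so in the coordinate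
   w = (1 - y) / y the second component evolves by the transposed product. *)
Lemma iter_ito_mobius n z : @Omega K z -> 0 < z.2 ->
  let M := farey_mx n z.1 in let z' := iter n (@ito K) z in
  let w := (1 - z.2) / z.2 in
  [/\ @Omega K z', 0 < z'.2
    , z.1 * (M 1 0 * z'.1 + M 1 1) = M 0 0 * z'.1 + M 0 1
    & (1 - z'.2) / z'.2 = (M 0 0 * w + M 1 0) / (M 0 1 * w + M 1 1)].
Proof.
move=> Oz z0; elim: n => [|n].
  rewrite /= /farey_mx big_nil -[1]mx2_scalar1 !mx2E; split=> //; first by ring.
  by rewrite mul1r addr0 mul0r add0r divr1.
cbv zeta; rewrite iterS; set z' := iter n _ z; move=> [[x01 /andP[y0 y1]] y'0 Ex Ew].
have [a [b [c [d [E ac bd d0 _]]]]] := farey_mx_nat n z.1.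
have w0 : 0 <= (1 - z.2) / z.2.
  by case: Oz => _ /andP[_ ?]; rewrite divr_ge0 ?subr_ge0// ltW.
move: Ex Ew; rewrite farey_mxS -iter_ito_fst -/z' E itoE/= => Ex Ew.
have x'01 := farey_itv _ x01; have x'K := fareyK _ x01.
have den0 : 0 < b%:R * ((1 - z.2) / z.2) + d%:R :> K.
  by apply: ltr_wpDl; [exact: mulr_ge0|rewrite ltr0n].
move: Ex Ew; rewrite !mx2E; move: ((1 - z.2) / z.2) w0 den0 => w w0 den0.
move: (farey z'.1) x'01 x'K => f x'01.
case: (eps z'.1) => /= x'K Ex Ew; rewrite mul_mx2 !mx2E.
  split=> //.
  - by split=> //=; rewrite invr_ge0 addr_ge0//= invf_le1; lra.
  - by rewrite invr_gt0; lra.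
  (* On this branch [z'.1] is 1 / (1 + f), so the old relation times 1 + f is the new one. *)
  - have x'1 : 1 + f != 0 by rewrite gt_eqF; lra.
    transitivity (z.1 * (c%:R * z'.1 + d%:R) * (1 + f)).
      by rewrite x'K; field.
    by rewrite Ex x'K; field.
  (* The branch y |-> 1 / (1 + y) acts as w |-> 1 / (1 + w): the new coordinate is [z'.2] itself,
     which is then expressed through the old one. *)
  - have -> : (1 - (1 + z'.2)^-1) / (1 + z'.2)^-1 = z'.2.
      by field; rewrite gt_eqF; lra.
    have -> : z'.2 = (1 + (1 - z'.2) / z'.2)^-1 by field; rewrite ?gt_eqF; lra.
    rewrite Ew -[X in (X + _)^-1](divff (lt0r_neq0 den0)) -mulrDl invf_div.
    by congr (_ / _); ring.
split=> //.
- by split=> //=; rewrite divr_ge0 ?addr_ge0//= ler_pdivrMr; lra.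
- by rewrite divr_gt0; lra.
- have x'1 : 1 + f != 0 by rewrite gt_eqF; lra.
  transitivity (z.1 * (c%:R * z'.1 + d%:R) * (1 + f)).
    by rewrite x'K; field.
  by rewrite Ex x'K; field.
(* The branch y |-> y / (1 + y) acts as w |-> w + 1. *)
- have -> : (1 - z'.2 / (1 + z'.2)) / (z'.2 / (1 + z'.2)) = (1 - z'.2) / z'.2 + 1.
    by field; rewrite ?gt_eqF; lra.
  by rewrite Ew -[X in _ + X](divff (lt0r_neq0 den0)) -mulrDl; congr (_ / _); ring.
Qed.

End farey.

(** * The induced map *)

Lemma inf_natP (P : nat -> Prop) n :
  inf_nat P = Some n <-> P n /\ forall k, (k < n)%N -> ~ P k.
Proof.
rewrite /inf_nat; case: pselect => [h|nh]; last first.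
  by split=> // -[Pn _]; case: nh; exists n; apply/asboolP.
case: ex_minnP => m /asboolP Pm mP; split=> [[<-]|[Pn nP]].
  by split=> // k km /asboolP/mP; rewrite leqNgt km.
congr Some; apply/eqP; rewrite eqn_leq mP; last exact/asboolP.
by rewrite /= leqNgt; apply/negP => /nP.
Qed.

Lemma inf_natPn (P : nat -> Prop) : inf_nat P = None <-> forall n, ~ P n.
Proof.
rewrite /inf_nat; case: pselect => [h|nh].
  by split=> // nP; exfalso; case: h => n /asboolP /nP.
by split=> // _ n Pn; apply: nh; exists n; apply/asboolP.
Qed.

Section induced_map.
Variables (K : realType) (R : set (K * K)).
Hypotheses (ROmega : R `<=` @Omega K) (posR : forall z, R z -> 0 < z.2).
Hypothesis sR1 : forall z, R z -> s_ R z = 1.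
Implicit Types (z p : K * K).

Lemma F_in z : R z -> R (F_ R z).
Proof. by rewrite /F_; case E : N_ => [n|//] _; case/inf_natP: E => -[]. Qed.

(** Whichever preimage [Finv_] selects lies in [R], where [s_] is 1, and the default value is 1 as
    well; the choice of preimage is thus harmless. *)
Lemma d_eq1 z : d_ R z = 1.
Proof.
rewrite /d_ /Finv_; case E : inf_nat => [n|//].
by case/inf_natP: E => -[_ /(xgetPex z)[/sR1]].
Qed.

(** The return time is positive, so u <= s = 1. For u = 0, determinant 1 would need t = -1; for u =
    1, determinant -1 would need t = r + 1, against t <= r. *)
Lemma A_cases z : R z -> N_ R z <> None ->
  (u_ R z = 0 /\ t_ R z = 1 /\ \det (A_ R z) = -1) \/
  (u_ R z = 1 /\ t_ R z = r_ R z - 1 /\ \det (A_ R z) = 1).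
Proof.
move=> Rz; have := sR1 _ Rz; rewrite det_mx2 /u_ /t_ /r_ /s_ /A_.
case E : N_ => [n|//] s1 _; case/inf_natP: E => -[n0 _] _.
have [a [b [c [d]]]] := farey_mx_nat K n z.1.
rewrite eqn0Ngt n0 addn0 => -[E ac bd d0 det].
move: s1; rewrite -/(farey_mx K n z.1) E !mx2E => /eqP; rewrite pnatr_eq1 => /eqP c1.
rewrite c1 !mulr1; move: ac det; rewrite c1 muln1.
case: a E => [|[|//]] E _ /= [] H; rewrite ?mul0r ?mul1r.
- by lia.
- left; have -> : b = 1%N by lia. rewrite sub0r; repeat split.
- right; rewrite (_ : d = (b + 1)%N) ?natrD ?mulr1n; last by lia.
  rewrite addrK addrC addKr; repeat split.
- by lia.
Qed.

(** This is [iter_ito_mobius] at the return time, with s = 1; the first relation stays free of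
    division. *)
Lemma return_coord z : R z -> N_ R z <> None ->
  let z' := F_ R z in let w := (1 - z.2) / z.2 in
  z.1 * (z'.1 + r_ R z) = u_ R z * z'.1 + t_ R z /\
  (1 - z'.2) / z'.2 = (u_ R z * w + 1) / (t_ R z * w + r_ R z).
Proof.
move=> Rz; have := sR1 _ Rz; rewrite /u_ /t_ /r_ /s_ /A_ /F_.
case E : N_ => [n|//] + _; rewrite -/(farey_mx K n z.1) => s1.
have [_ _] := iter_ito_mobius K n z (ROmega _ Rz) (posR _ Rz).
by rewrite s1 mul1r.
Qed.

Lemma r_ge1 z : R z -> N_ R z <> None -> 1 <= r_ R z.
Proof.
move=> Rz; rewrite /r_ /A_; case: N_ => [n _|//].
have [a [b [c [d [+ _ _ d0 _]]]]] := farey_mx_nat K n z.1.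
by rewrite -/(farey_mx K n z.1) => ->; rewrite mx2E ler1n.
Qed.

(** A point that never returns carries the default matrix A_1, whose u is 0. For u = 1 the relation
    x (x' + r) = x' + r - 1 excludes x = 1. *)
Lemma u_neq0 z : R z -> u_ R z != 0 -> [/\ N_ R z <> None, u_ R z = 1 & z.1 < 1].
Proof.
move=> Rz u0.
have Nz : N_ R z <> None.
  by move: u0; rewrite /u_ /A_; case: N_ => //; rewrite /fareyA mx2E eqxx.
have [[E]|[u1 [tr _]]] := A_cases _ Rz Nz; first by rewrite E eqxx in u0.
split=> //; have [+ _] := return_coord _ Rz Nz.
have [/andP[_ x1] _] := ROmega _ Rz; have r1 := r_ge1 _ Rz Nz.
rewrite u1 tr lt_neqAle x1 andbT => H; apply/negP => /eqP z1.
by move: H; rewrite z1; lra.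
Qed.

Lemma phi_inj z1 z2 : R z1 -> R z2 -> phi_ R z1 = phi_ R z2 -> z1 = z2.
Proof.
move=> Rz1 Rz2; have y1 := posR _ Rz1; have y2 := posR _ Rz2.
have [/andP[x10 _] _] := ROmega _ Rz1; have [/andP[x20 _] _] := ROmega _ Rz2.
rewrite /phi_; have [_|/(u_neq0 _ Rz1)[_ _ x1]] := eqVneq (u_ R z1) 0;
  have [_|/(u_neq0 _ Rz2)[_ _ x2]] := eqVneq (u_ R z2) 0;
  rewrite [z1]surjective_pairing [z2]surjective_pairing/= => -[e1 e2].
- congr (_, _) => //; move: e2; rewrite !mulrBl !mul1r !divff ?gt_eqF//.
  by move=> /addIr/invr_inj.
(* In the mixed cases X = x >= 0 in one chart and X = x - 1 < 0 in the other. *)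
- by exfalso; lra.
- by exfalso; lra.
- by congr (_, _); lra.
Qed.

Lemma phiK z : R z -> phiinv_ R (phi_ R z) = z.
Proof.
move=> Rz; rewrite /phiinv_; case: xgetP => [y _ [Ry /phi_inj]|/(_ z)]; first exact.
by case.
Qed.

Lemma tau_stable p : Omega_ R p -> Omega_ R (tau_ R p).
Proof.
move=> [z Rz <-]; rewrite /tau_; case: ifP => _; first by exists z.
by rewrite phiK//; exists (F_ R z) => //; exact: F_in.
Qed.

Lemma tauE X Y : Omega_ R (X, Y) -> X != 0 ->
  let z := phiinv_ R (X, Y) in
  N_ R z <> None ->
  tau_ R (X, Y) =
    (alpha_ R z / X - beta_ R z, 1 / (beta_ R z + alpha_ R z * Y)).
Proof.
move=> [z Rz zp] X0; rewrite -zp phiK// => z0 Nz; rewrite {}/z0 in Nz *.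
rewrite /tau_ zp /= (negbTE X0) -zp phiK//.
have Rz' := F_in _ Rz.
rewrite /alpha_ /beta_ d_eq1 !sR1// !mulr1 mul1r.
have [/andP[x0 x1] /andP[y0 y1]] := ROmega _ Rz; have y_gt0 := posR _ Rz.
have y'_gt0 := posR _ Rz'; have r1 := r_ge1 _ Rz Nz.
have [Ex Ew] := return_coord _ Rz Nz.
(* Here alpha = -det and beta = u' + r. These three facts do not involve the chart at the image
   point, so the cases u' = 0, 1 are treated once, before those of u. *)
suff [q_gt0 Ex' Ew'] : [/\ 0 < r_ R z + - \det (A_ R z) * Y,
    (F_ R z).1 = - \det (A_ R z) / X - r_ R z
  & (1 - (F_ R z).2) / (F_ R z).2 = (r_ R z + - \det (A_ R z) * Y)^-1].
  rewrite {1}/phi_; have [->|/(u_neq0 _ Rz')[_ -> _]] := eqVneq (u_ R (F_ R z)) 0.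
    by rewrite Ex' Ew' add0r mul1r.
  rewrite Ex'; congr (_, _); first by ring.
  move: Ew' q_gt0; rewrite -addrA; move: (r_ R z + _) => q Ew' q_gt0.
  have -> : 1 - (F_ R z).2 = (F_ R z).2 / q by rewrite -Ew'; field; rewrite gt_eqF.
  (* This solves (1 - y') / y' = 1 / q for y'; the chart coordinate 1 - y' is then 1 / (1 + q). *)
  have E : (F_ R z).2 = q / (1 + q).
    apply: (mulIf (_ : 1 + q != 0)); first by rewrite gt_eqF//; lra.
    rewrite divfK; last by rewrite gt_eqF//; lra.
    move: Ew' => /(congr1 (fun t => t * (q * (F_ R z).2))) Ew'.
    have {}Ew' : q * (1 - (F_ R z).2) = (F_ R z).2.
      transitivity ((1 - (F_ R z).2) / (F_ R z).2 * (q * (F_ R z).2)).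
        by field; rewrite gt_eqF.
      by rewrite Ew'; field; rewrite gt_eqF.
    by lra.
  by rewrite E; field; rewrite !gt_eqF//; lra.
move: zp Ex Ew; rewrite /phi_.
have [[-> [-> ->]]|[-> [-> ->]]] := A_cases _ Rz Nz; rewrite ?eqxx ?oner_eq0.
  (* Case u = 0: X = x, Y = w, det = -1, and the relations read x (x' + r) = 1 and w' = 1 / (w +
     r). *)
  case=> <- <-; rewrite opprK !mul1r mul0r !add0r => Ex Ew.
  have x_neq0 : z.1 != 0 by apply/eqP => x_eq0; move: Ex; rewrite x_eq0 mul0r; lra.
  have w0 : 0 <= (1 - z.2) / z.2 by rewrite divr_ge0 ?subr_ge0.
  split; first by lra.
    by apply: (mulfI x_neq0); rewrite mulrBr mulfV//; lra.
  by rewrite Ew mul0r add0r mul1r [X in _ = X^-1]addrC.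
(* Case u = 1: X = x - 1, Y = 1 - y, det = 1. The first relation becomes X (x' + r) = -1; expanding
   the fraction for w' by y gives 1 / (r - 1 + y) = 1 / (r - Y). *)
case=> EX EY; rewrite !mul1r => Ex Ew; split; first by lra.
  have {}Ex : X * ((F_ R z).1 + r_ R z) = - 1 by rewrite -EX; lra.
  by rewrite -Ex; field.
have den : 0 < r_ R z - 1 + z.2 by lra.
rewrite Ew -EY [X in _ = X^-1](_ : _ = r_ R z - 1 + z.2); last by ring.
rewrite (_ : (r_ R z - 1) * _ + _ = (r_ R z - 1 + z.2) / z.2); last first.
  by field; rewrite gt_eqF.
by field; rewrite !gt_eqF.
Qed.

End induced_map.

(** * Change of variables for the Lebesgue measure *)

(** Inversion is continuous off 0, and the default value at 0 sits on a measurable singleton. *)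
Lemma invr_measurable (K : realType) : measurable_fun [set: K] (@GRing.inv K).
Proof.
rewrite -(setUCl [set 0 : K]); apply/measurable_funU => //.
  by apply: measurableC; exact: measurable_set1.
split; last exact: measurable_fun_set1.
apply: open_continuous_measurable_fun.
  apply: closed_openC; apply: accessible_closed_set1.
  exact: hausdorff_accessible (@Rhausdorff K).
by move=> x; rewrite inE => /eqP x0; exact: inv_continuous.
Qed.

(** * Measures given by a density *)

Section density.
Local Open Scope ereal_scope.
Context d (T : measurableType d) (K : realType).
Variables (mu : {measure set T -> \bar K}) (w : T -> K).
Hypotheses (w_ge0 : forall x, (0 <= w x)%R) (mw : measurable_fun setT w).

(* The positivity and measurability arguments only make the measure instance
   below inferable. *)
Definition mdensity (_ : forall x, (0 <= w x)%R) (_ : measurable_fun setT w)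
  (A : set T) : \bar K := \int[mu]_(x in A) (w x)%:E.

Local Notation nu := (mdensity w_ge0 mw).

Let mdensity0 : nu set0 = 0.
Proof. by rewrite /mdensity integral_set0. Qed.

Let mdensity_ge0 A : 0 <= nu A.
Proof. by apply: integral_ge0 => x _; rewrite lee_fin. Qed.

Let mdensity_sigma_additive : semi_sigma_additive nu.
Proof.
move=> F mF tF mUF; rewrite /mdensity; apply: cvg_toP.
  apply: ereal_nondecreasing_is_cvgn => m n mn.
  apply: lee_sum_nneg_natr => // k _ _.
  by apply: integral_ge0 => x _; rewrite lee_fin.
rewrite ge0_integral_bigcup//.
- exact/measurable_EFinP/measurable_funTS.
- by move=> x _; rewrite lee_fin.
Qed.

HB.instance Definition _ := isMeasure.Build _ _ _ nu
  mdensity0 mdensity_ge0 mdensity_sigma_additive.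

Import HBNNSimple.

(** By monotone convergence along simple functions increasing to [f], it is enough to treat
    indicators, for which this is the definition of [mdensity]. *)
Lemma ge0_integral_mdensity D (f : T -> \bar K) :
  measurable D -> measurable_fun D f -> (forall x, D x -> 0 <= f x) ->
  \int[nu]_(x in D) f x = \int[mu]_(x in D) (f x * (w x)%:E).
Proof.
move=> mD mf f0; pose h := nnsfun_approx mD mf.
have mwE : measurable_fun D (fun x => (w x)%:E).
  exact/measurable_EFinP/measurable_funTS.
transitivity (limn (fun n => \int[nu]_(x in D) (h n x)%:E)).
  rewrite -monotone_convergence//.
  - apply: eq_integral => x /[!inE] xD; apply/esym/cvg_lim => //.
    exact: cvg_nnsfun_approx.
  - by move=> n; exact/measurable_EFinP/measurable_funTS.
  - by move=> n x _; rewrite lee_fin.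
  - by move=> x _ m n mn; rewrite lee_fin; exact/lefP/nd_nnsfun_approx.
transitivity (limn (fun n => \int[mu]_(x in D) ((h n x)%:E * (w x)%:E))); last first.
  rewrite -monotone_convergence//.
  - apply: eq_integral => x /[!inE] xD; apply/cvg_lim => //.
    by apply: cvgeZr => //; exact: cvg_nnsfun_approx.
  - move=> n; apply: emeasurable_funM => //.
    exact/measurable_EFinP/measurable_funTS.
  - by move=> n x _; rewrite mule_ge0 ?lee_fin.
  - move=> x _ m n mn; rewrite lee_wpmul2r ?lee_fin//.
    exact/lefP/nd_nnsfun_approx.
congr (limn _); apply/funext => n.
under [RHS]eq_integral => x _.
  rewrite fimfunE -fsumEFin// ge0_mule_fsuml; last first.
    by move=> r; exact: nnfun_muleindic_ge0.
  over.
under [LHS]eq_integral do rewrite fimfunE -fsumEFin//.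
have mind r : measurable_fun D (fun x => (r * \1_(h n @^-1` [set r]) x)%:E).
  by apply/measurable_EFinP/measurable_funTS; exact: measurable_funM.
rewrite ge0_integral_fsum//; last by move=> r x _; exact: nnfun_muleindic_ge0.
rewrite ge0_integral_fsum//; last 2 first.
- by move=> r; exact: emeasurable_funM.
- by move=> r x _; apply: mule_ge0; [exact: nnfun_muleindic_ge0|rewrite lee_fin].
apply: eq_fsbigr => r _; rewrite integralZl_indic_nnsfun// integral_indic//.
under [RHS]eq_integral do rewrite EFinM -muleA.
(* A nonnegative simple function has empty level sets at negative [r]. *)
have [r0|r0] := ltP r 0%R.
  rewrite preimage_nnfun0// set0I measure0 mule0 integral0_eq// => x _.
  by rewrite indic0 mul0e mule0.
rewrite ge0_integralZl//; last 2 first.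
- apply: emeasurable_funM => //.
  exact/measurable_EFinP/measurable_funTS.
- by move=> x _; rewrite mule_ge0 ?lee_fin.
congr (_ * _); rewrite setIC [LHS]integral_mkcondr.
apply: eq_integral => x _; rewrite patchE /= indicE.
by case: (x \in _); rewrite ?mul1e ?mul0e.
Qed.

End density.
Arguments mdensity {d T K} mu {w} _ _.

(** * Substitutions on the line *)

Section substitution.
Variable K : realType.
Local Notation T := (measurableTypeR K).
Local Notation mu := (@lebesgue_measure K).

(** The primitive is -1/x. The half-open shape is that of the preimage of []p, q]] under the
    decreasing map y |-> 1/y - 1. *)
Lemma integral_sqr_inv (a b : K) : 0 < a -> a < b ->
  (\int[mu]_(x in `[a, b[) ((x ^+ 2)^-1)%:E = (a^-1 - b^-1)%:E)%E.
Proof.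
move=> a0 ab.
have cV (x : K) : 0 < x -> {for x, continuous (fun y : K => (y ^+ 2)^-1)}.
  move=> x0; apply: continuousV; first by rewrite gt_eqF// exprn_gt0.
  exact: exprn_continuous.
have cN (x : K) : 0 < x -> {for x, continuous (fun y : K => - y^-1)}.
  by move=> x0; apply: continuousN; apply: inv_continuous; rewrite gt_eqF.
have dN (x : K) : 0 < x -> is_derive x 1 (fun y : K => - y^-1) ((x ^+ 2)^-1).
  move=> x0; have x_neq0 : id x != 0 by rewrite gt_eqF.
  have := is_deriveN (is_deriveV x_neq0 (is_derive_id x 1)).
  by rewrite scaleNr opprK /GRing.scale/= mulr1.
rewrite integral_itv_bndo_bndc; last first.
  apply/measurable_EFinP/measurable_funTS.
  by apply: (measurableT_comp (invr_measurable K)); exact: exprn_measurable.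
rewrite (@continuous_FTC2 _ _ (fun y => - y^-1) _ _ ab).
- by rewrite -EFinB opprK addrC.
- apply: continuous_in_subspaceT => x; rewrite inE/= in_itv/= => /andP[ax _].
  exact/cV/(lt_le_trans a0).
- split.
  + by move=> x; rewrite in_itv/= => /andP[ax _]; have [] := dN _ (lt_trans a0 ax).
  + exact/cvg_at_right_filter/cN.
  + exact/cvg_at_left_filter/cN/(lt_trans a0).
- move=> x; rewrite in_itv/= => /andP[ax _]; rewrite derive1E.
  by have [_ ->] := dN _ (lt_trans a0 ax).
Qed.

(* Both sides are integrals of G for measures that agree on the half-open
   intervals. *)
Lemma ge0_integral_lebesgue_substitution (E : set T) (w : T -> K) (h : T -> T)
    (G : T -> \bar K) : measurable E ->
  (forall y, 0 <= w y) -> measurable_fun setT w -> measurable_fun setT h ->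
  (forall a b : K, a < b ->
    (\int[mu]_(y in h @^-1` `]a, b]) (w y)%:E = mu (`]a, b] `&` E))%E) ->
  measurable_fun setT G -> (forall y, 0 <= G y)%E ->
  (\int[mu]_(Y in E) G Y = \int[mu]_y (G (h y) * (w y)%:E))%E.
Proof.
move=> mE w0 mw mh wE mG G0.
have i0 y : 0 <= (\1_E : T -> K) y by [].
have mi : measurable_fun setT (\1_E : T -> K) by [].
have mitv (a b : K) : measurable (`]a, b]%classic : set T) by exact: measurable_itv.
have [push pushE] : exists push : {measure set T -> \bar K},
    push = pushforward (mdensity mu w0 mw) h :> (set T -> \bar K).
  by unshelve eexists; [refine (pushforward (mdensity mu w0 mw) h)|].
transitivity (\int[mdensity mu i0 mi]_Y G Y)%E.
  rewrite ge0_integral_mdensity// [LHS]integral_mkcond.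
  by apply: eq_integral => y _; rewrite epatch_indic.
transitivity (\int[push]_Y G Y)%E; last first.
  rewrite pushE (ge0_integral_pushforward mh)// preimage_setT.
  rewrite ge0_integral_mdensity//; last by move=> y _; exact: G0.
  exact: measurableT_comp.
apply: eq_measure_integral => A mA _.
(* The half-open intervals form a generating pi-system, and the intervals ]-n, n] exhaust the line
   with finite measure. *)
apply: (@measure_unique _ K T (@ocitv K) (fun n => `](- n%:R), n%:R]%classic)
  _ _ _ _ (mdensity mu i0 mi) push) => //.
- exact: ocitvI.
- by move=> n; exact: is_ocitv.
- apply/seteqP; split=> // x _; exists (Num.truncn `|x|).+1 => //=.
  rewrite in_itv/=; have := truncnS_gt `|x|; rewrite ltr_norml.
  by case/andP => -> /ltW ->.
- move=> _ [[a b] _ <-]; rewrite pushE /pushforward /=.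
  have [ab|ba] := ltP a b; last first.
    by rewrite set_itv_ge ?preimage_set0 ?measure0// bnd_simp -leNgt.
  by rewrite [LHS](integral_indic mu (mitv a b) mE) setIC; exact/esym/wE.
- move=> n; rewrite [X in (X < _)%E](integral_indic mu (mitv _ _) mE).
  apply: (@le_lt_trans _ _ (mu `](- n%:R), n%:R]%classic)).
    by rewrite le_measure// inE//; exact: measurableI.
  by rewrite lebesgue_measure_itv/=; case: ifP => _; rewrite ?ltry// -EFinB ltry.
Qed.

Lemma ge0_integral_inv_shift (G : T -> \bar K) :
  measurable_fun setT G -> (forall y, 0 <= G y)%E ->
  (\int[mu]_(Y in `]0%R, +oo[) G Y =
   \int[mu]_(y in `]0%R, 1%R[) (G (y^-1 - 1)%R * ((y ^+ 2)^-1)%:E))%E.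
Proof.
move=> mG G0.
rewrite (@ge0_integral_lebesgue_substitution _
  (fun y => \1_(`]0, 1[) y * (y ^+ 2)^-1) (fun y => y^-1 - 1))//.
- rewrite [RHS]integral_mkcond; apply: eq_integral => y _.
  by rewrite patchE indicE; case: (y \in _); rewrite ?mul1r ?mul0r ?mule0.
- by move=> y; rewrite mulr_ge0// invr_ge0 exprn_even_ge0.
- apply: measurable_funM => //.
  by apply: (measurableT_comp (invr_measurable K)); exact: exprn_measurable.
- by apply: measurable_funB => //; exact: invr_measurable.
(* Clipping the endpoints at 0 describes the part of []a, b]] on the positive half-line; its
   preimage in ]0, 1[ runs from 1/(1 + q) to 1/(1 + p). *)
move=> a b ab; pose p := Num.max a 0; pose q := Num.max b 0.
have p0 : 0 <= p by rewrite le_max lexx orbT.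
have q0 : 0 <= q by rewrite le_max lexx orbT.
have -> : `]a, b] `&` `]0, +oo[ = `]p, q]%classic :> set T.
  apply/seteqP; split=> x /=; rewrite !in_itv/= andbT gt_max le_max.
    by case=> /andP[-> ->] ->.
  case/andP => /andP[-> x0]; rewrite x0 [x <= 0]leNgt x0 orbF => -> //.
transitivity (\int[mu]_(y in `[((1 + q)^-1)%R, ((1 + p)^-1)%R[) ((y ^+ 2)^-1)%:E)%E.
  rewrite (_ : `[_, _[%classic = (fun y : T => y^-1 - 1) @^-1` `]a, b] `&` `]0, 1[).
    rewrite [RHS]integral_mkcondr; apply: eq_integral => y _.
    by rewrite patchE indicE; case: (y \in _); rewrite ?mul1r ?mul0r.
  have le_q (y : K) : 0 < y -> ((1 + q)^-1 <= y) = (y^-1 - 1 <= q).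
    by move=> y0; rewrite -lef_pV2 ?posrE ?invr_gt0 ?invrK ?lerBlDl//; lra.
  have lt_p (y : K) : 0 < y -> (y < (1 + p)^-1) = (p < y^-1 - 1).
    by move=> y0; rewrite -ltf_pV2 ?posrE ?invr_gt0 ?invrK ?ltrBrDl//; lra.
  have lt_0 (y : K) : 0 < y -> (y < 1) = (0 < y^-1 - 1).
    by move=> y0; rewrite subr_gt0 invf_gt1.
  apply/seteqP; split=> y /=; rewrite !in_itv/=.
    move=> /andP[qy yp].
    have y0 : 0 < y by rewrite (lt_le_trans _ qy)// invr_gt0 ltr_pwDl.
    move: qy yp; rewrite le_q// lt_p// y0 lt_0// gt_max le_max.
    by move=> /orP[->|+] /andP[-> y1]; rewrite y1// leNgt y1.
  move=> [/andP[ay yb] /andP[y0]].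
  by rewrite le_q// lt_p// lt_0// gt_max le_max ay yb => ->.
rewrite lebesgue_measure_itv/= lte_fin.
have [pq|qp] := ltP p q; last first.
  by rewrite set_itv_ge ?integral_set0// bnd_simp -leNgt lef_pV2 ?posrE; lra.
rewrite integral_sqr_inv ?invr_gt0 ?ltf_pV2 ?posrE; [|lra..].
by rewrite !invrK EFinB; congr (_%:E); lra.
Qed.

Lemma ge0_integral_addr (c : K) (G : T -> \bar K) :
  measurable_fun setT G -> (forall y, 0 <= G y)%E ->
  (\int[mu]_x G x = \int[mu]_x G (x + c)%R)%E.
Proof.
move=> mG G0.
rewrite (@ge0_integral_lebesgue_substitution _ (cst 1) (fun y => y + c))//.
- by apply: eq_integral => y _; rewrite mule1.
- exact: measurable_funD.
move=> a b ab; rewrite (_ : _ @^-1` _ = `]a - c, b - c]%classic); last first.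
  apply/seteqP; split=> y /=; rewrite !in_itv/= => /andP[? ?].
    by apply/andP; split; lra.
  by apply/andP; split; lra.
rewrite setIT [LHS](integral_cst mu (measurable_itv _) 1%E) mul1e
  [LHS]lebesgue_measure_itv [RHS]lebesgue_measure_itv/= !lte_fin ltrD2r ab.
by rewrite -!EFinB; congr (_%:E); ring.
Qed.

Lemma ge0_integral_onem (G : T -> \bar K) :
  measurable_fun setT G -> (forall y, 0 <= G y)%E ->
  (\int[mu]_x G x = \int[mu]_x G (1 - x)%R)%E.
Proof.
move=> mG G0.
rewrite (@ge0_integral_lebesgue_substitution _ (cst 1) (fun y => 1 - y))//.
- by apply: eq_integral => y _; rewrite mule1.
- exact: measurable_funB.
move=> a b ab; rewrite (_ : _ @^-1` _ = `[1 - b, 1 - a[%classic); last first.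
  apply/seteqP; split=> y /=; rewrite !in_itv/= => /andP[? ?].
    by apply/andP; split; lra.
  by apply/andP; split; lra.
rewrite setIT [LHS](integral_cst mu (measurable_itv _) 1%E) mul1e
  [LHS]lebesgue_measure_itv [RHS]lebesgue_measure_itv/= !lte_fin ltrD2l ltrN2 ab.
by rewrite -!EFinB; congr (_%:E); ring.
Qed.

End substitution.

(** * Substitutions in the plane *)

Section substitution2.
Variable K : realType.
Local Notation T := (measurableTypeR K).
Local Notation mu := (@lebesgue_measure K).

(** The added endpoints Y = 0 and y = 1 are null; they are included because [R] may meet the line y
    = 1. *)
Lemma ge0_integral_inv_shift_closed (G : T -> \bar K) :
  measurable_fun setT G -> (forall y, 0 <= G y)%E ->
  (\int[mu]_(Y in `[0%R, +oo[) G Y =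
   \int[mu]_(y in `]0%R, 1%R]) (G (y^-1 - 1)%R * ((y ^+ 2)^-1)%:E))%E.
Proof.
move=> mG G0; rewrite -integral_itv_obnd_cbnd; last exact: measurable_funTS.
rewrite -integral_itv_bndo_bndc; first exact: ge0_integral_inv_shift.
apply: emeasurable_funM.
  apply: measurable_funTS; apply: measurableT_comp => //.
  by apply: measurable_funB => //; exact: invr_measurable.
apply/measurable_EFinP/measurable_funTS.
by apply: (measurableT_comp (invr_measurable K)); exact: exprn_measurable.
Qed.

(** Tonelli's theorem, after extension by zero to the plane, reduces this to the substitution on
    each fibre of constant x. *)
Lemma ge0_integral_lebesgue2_inv_shift (g : T * T -> \bar K) :
  measurable_fun setT g -> (forall p, 0 <= g p)%E ->
  (\int[@lebesgue2 K]_(p in [set: T] `*` `[0%R, +oo[) g p =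
   \int[@lebesgue2 K]_(z in [set: T] `*` `]0%R, 1%R])
     (g (z.1, z.2^-1 - 1)%R * ((z.2 ^+ 2)^-1)%:E))%E.
Proof.
move=> mg g0.
have mi0y : measurable ([set: T] `*` `[0, +oo[%classic : set (T * T)).
  by apply: measurableX => //; exact: measurable_itv.
have mi01 : measurable ([set: T] `*` `]0, 1]%classic : set (T * T)).
  by apply: measurableX => //; exact: measurable_itv.
have mgw : measurable_fun setT
    (fun z : T * T => g (z.1, z.2^-1 - 1)%R * ((z.2 ^+ 2)^-1)%:E)%E.
  apply: emeasurable_funM.
    apply: measurableT_comp => //; apply: measurable_fun_pair => //.
    apply: measurable_funB => //.
    by apply: (measurableT_comp (invr_measurable K)).
  apply/measurable_EFinP; apply: (measurableT_comp (invr_measurable K)).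
  exact: measurable_funX.
rewrite integral_mkcond [RHS]integral_mkcond.
rewrite fubini_tonelli1; last 2 first.
- by apply/(measurable_restrictT _ mi0y); exact: measurable_funTS.
- exact: erestrict_ge0.
rewrite [RHS]fubini_tonelli1; last 2 first.
- by apply/(measurable_restrictT _ mi01); exact: measurable_funTS.
- by apply: erestrict_ge0 => z _; rewrite mule_ge0// lee_fin invr_ge0 exprn_even_ge0.
apply: eq_integral => x _; rewrite /fubini_F.
transitivity (\int[mu]_(Y in `[0%R, +oo[) g (x, Y))%E.
  rewrite [RHS]integral_mkcond; apply: eq_integral => y _.
  rewrite !patchE; congr (if _ then _ else _).
  by apply/idP/idP; rewrite !inE => // -[].
rewrite (ge0_integral_inv_shift_closed (fun Y => g (x, Y)))//; last first.
  exact: measurableT_comp.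
rewrite [LHS]integral_mkcond; apply: eq_integral => y _.
rewrite !patchE; congr (if _ then _ else _).
by apply/idP/idP; rewrite !inE => // -[].
Qed.

(** By Tonelli's theorem, the reflection is applied to the inner integral and the translation to the
    outer one. *)
Lemma ge0_integral_lebesgue2_flip (g : T * T -> \bar K) :
  measurable_fun setT g -> (forall p, 0 <= g p)%E ->
  (\int[@lebesgue2 K]_p g p =
   \int[@lebesgue2 K]_z g (z.1 - 1, 1 - z.2)%R)%E.
Proof.
move=> mg g0.
have mg1 : measurable_fun setT (fun z : T * T => g (z.1, 1 - z.2)).
  apply: measurableT_comp => //; apply: measurable_fun_pair => //.
  exact: measurable_funB.
rewrite fubini_tonelli1// [RHS]fubini_tonelli1//; last first.
  apply: measurableT_comp => //.
  by apply: measurable_fun_pair; apply: measurable_funB.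
rewrite /fubini_F.
under eq_integral => x _.
  rewrite (ge0_integral_onem _ (fun y => g (x, y)))//; last first.
    exact: measurableT_comp.
  over.
rewrite (ge0_integral_addr _ (-1) (fun x => \int[mu]_y g (x, 1 - y)%R)%E)//.
- exact: (@measurable_fun_fubini_tonelli_F _ _ _ _ _ mu _ mg1 (fun _ => g0 _)).
- by move=> x; exact: integral_ge0.
Qed.

End substitution2.

(** * Measurability of the return time *)

Section measurability.
Variable K : realType.
Local Notation T := (measurableTypeR K).

Lemma measurable_eps : measurable_fun [set: T] (@eps K).
Proof. exact: measurable_fun_ltr. Qed.

Lemma measurable_farey : measurable_fun [set: T] (@farey K : T -> T).
Proof.
rewrite (_ : @farey K = fun x => if eps x then (1 - x) / x else x / (1 - x)).
  apply: measurable_fun_ifT; first exact: measurable_eps.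
    apply: measurable_funM; first exact: measurable_funB.
    exact: invr_measurable.
  apply: measurable_funM => //.
  by apply: (measurableT_comp (invr_measurable K)); exact: measurable_funB.
by apply/funext => x; exact: fareyE.
Qed.

Lemma measurable_ito : measurable_fun [set: T * T] (@ito K : T * T -> T * T).
Proof.
rewrite (_ : @ito K = fun z =>
  (farey z.1, if eps z.1 then (1 + z.2)^-1 else z.2 / (1 + z.2))).
  apply: measurable_fun_pair; first exact: (measurableT_comp measurable_farey).
  have m1D : measurable_fun [set: T * T] (fun z : T * T => (1 + z.2)^-1).
    by apply: (measurableT_comp (invr_measurable K)); exact: measurable_funD.
  apply: measurable_fun_ifT => //; first exact: (measurableT_comp measurable_eps).
  exact: measurable_funM.
by apply/funext => z; exact: itoE.
Qed.

Lemma measurable_iter_ito n :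
  measurable_fun [set: T * T] (iter n (@ito K) : T * T -> T * T).
Proof.
elim: n => [|n IH]; first exact: measurable_id.
exact: (measurableT_comp measurable_ito).
Qed.

Lemma measurable_iter_farey n : measurable_fun [set: T] (iter n (@farey K) : T -> T).
Proof.
elim: n => [|n IH]; first exact: measurable_id.
exact: (measurableT_comp measurable_farey).
Qed.

Lemma measurable_farey_mx n i j :
  measurable_fun [set: T] (fun x : T => farey_mx K n x i j).
Proof.
elim: n i j => [|n IH] i j.
  by rewrite /farey_mx; under eq_fun do rewrite big_nil; exact: measurable_cst.
under eq_fun do rewrite farey_mxS mxE !big_ord_recl big_ord0 addr0.
have mA k : measurable_fun [set: T]
    (fun x : T => fareyA K (eps (iter n (@farey K) x)) k j).
  rewrite (_ : (fun _ => _) = fun x => if eps (iter n (@farey K) x)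
    then fareyA K true k j else fareyA K false k j); last first.
    by apply/funext => x; case: (eps _).
  apply: measurable_fun_ifT => //.
  exact: (measurableT_comp measurable_eps (measurable_iter_farey n)).
by apply: measurable_funD; apply: measurable_funM.
Qed.

Variable R : set (T * T).
Hypothesis mR : measurable R.

Lemma measurable_N_ o : measurable [set z : T * T | N_ R z = o].
Proof.
have mret n : measurable [set z : T * T | R (iter n (@ito K) z)].
  by rewrite -[X in measurable X]setTI; exact: measurable_iter_ito.
have mret1 n : measurable [set z : T * T | (1 <= n)%N /\ R (iter n (@ito K) z)].
  case: (leqP 1 n) => n1.
    rewrite (_ : [set z | _] = [set z | R (iter n (@ito K) z)])//.
    by apply/seteqP; split=> z //= [].
  by rewrite (_ : [set z | _] = set0)//; apply/seteqP; split=> z //= [].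
case: o => [n|].
  rewrite (_ : [set z | _] =
      [set z | (1 <= n)%N /\ R (iter n (@ito K) z)] `&`
      \bigcap_(k in [set k | (k < n)%N])
        ~` [set z | (1 <= k)%N /\ R (iter k (@ito K) z)]).
    apply: measurableI => //; apply: bigcap_measurableType => k _.
    exact: measurableC.
  apply/seteqP; split=> z /=.
    by move=> /inf_natP[].
  by move=> [? H]; apply/inf_natP.
rewrite (_ : [set z | _] =
    \bigcap_(k in setT) ~` [set z | (1 <= k)%N /\ R (iter k (@ito K) z)]).
  by apply: bigcap_measurableType => k _; exact: measurableC.
apply/seteqP; split=> z /=.
  by move=> /inf_natPn H k _; exact: H.
by move=> H; apply/inf_natPn => n; exact: H.
Qed.

(** On each level set of the return time, [u_] is an entry of a fixed-length product; the points
    that never return have u = 0 by default. *)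
Lemma measurable_u_eq0 : measurable [set z : T * T | u_ R z = 0].
Proof.
rewrite (_ : [set z | _] = [set z | N_ R z = None] `|`
    \bigcup_n ([set z | N_ R z = Some n] `&` [set z | farey_mx K n z.1 0 0 = 0])).
  apply: measurableU; first exact: measurable_N_.
  apply: bigcup_measurable => n _; apply: measurableI; first exact: measurable_N_.
  have mf : measurable_fun [set: T * T] (fun z : T * T => farey_mx K n z.1 0 0).
    exact: (measurableT_comp (measurable_farey_mx n 0 0)).
  by rewrite -[X in measurable X]setTI; exact: (mf measurableT [set 0]).
apply/seteqP; split=> z /=; rewrite /u_ /A_.
  by case E : (N_ R z) => [n|] H; [right; exists n|left].
by move=> [->|[n _ [-> H]]]//; rewrite /fareyA mx2E.
Qed.

End measurability.

(** * The two charts of phi_ *)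

Section charts.
Variable K : realType.
Local Notation T := (measurableTypeR K).
Implicit Types (S B : set (T * T)) (z p : T * T).

(** With 1/y - 1 in place of (1 - y)/y and 0^-1 = 0, [chart0] and [chart0V] are mutually inverse on
    the whole plane. *)
Definition chart0 z : T * T := (z.1, z.2^-1 - 1).
Definition chart0V p : T * T := (p.1, (1 + p.2)^-1).
Definition chart1 z : T * T := (z.1 - 1, 1 - z.2).
Definition chart1V p : T * T := (p.1 + 1, 1 - p.2).
Definition mu_density z : K := ((z.1 + z.2 - z.1 * z.2) ^+ 2)^-1.
Definition nu_density p : K := ((1 + p.1 * p.2) ^+ 2)^-1.

Lemma chart0K z : chart0V (chart0 z) = z.
Proof. by case: z => x y; rewrite /chart0V /chart0/= addrCA subrr addr0 invrK. Qed.

Lemma chart0VK p : chart0 (chart0V p) = p.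
Proof. by case: p => x y; rewrite /chart0V /chart0/= invrK addrC addKr. Qed.

Lemma chart1K z : chart1V (chart1 z) = z.
Proof. by case: z => x y; rewrite /chart1V /chart1/= subrK subKr. Qed.

Lemma chart1VK p : chart1 (chart1V p) = p.
Proof. by case: p => x y; rewrite /chart1V /chart1/= addrK subKr. Qed.

Lemma measurable_chart0 : measurable_fun setT chart0.
Proof.
apply: measurable_fun_pair => //; apply: measurable_funB => //.
exact: (measurableT_comp (invr_measurable K)).
Qed.

Lemma measurable_chart0V : measurable_fun setT chart0V.
Proof.
apply: measurable_fun_pair => //.
by apply: (measurableT_comp (invr_measurable K)); exact: measurable_funD.
Qed.

Lemma measurable_chart1 : measurable_fun setT chart1.
Proof. by apply: measurable_fun_pair; apply: measurable_funB. Qed.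

Lemma measurable_chart1V : measurable_fun setT chart1V.
Proof.
by apply: measurable_fun_pair; [apply: measurable_funD|apply: measurable_funB].
Qed.

Lemma mu_density_ge0 z : 0 <= mu_density z.
Proof. by rewrite invr_ge0 exprn_even_ge0. Qed.

Lemma nu_density_ge0 p : 0 <= nu_density p.
Proof. by rewrite invr_ge0 exprn_even_ge0. Qed.

Lemma measurable_mu_density : measurable_fun setT mu_density.
Proof.
apply: (measurableT_comp (invr_measurable K)); apply: measurable_funX.
apply: measurable_funB; first exact: measurable_funD.
exact: measurable_funM.
Qed.

Lemma measurable_nu_density : measurable_fun setT nu_density.
Proof.
apply: (measurableT_comp (invr_measurable K)); apply: measurable_funX.
by apply: measurable_funD => //; exact: measurable_funM.
Qed.

(** Since 1 + x (1/y - 1) = (x + y - xy) / y, the Jacobian 1/y^2 cancels. *)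
Lemma nu_density_chart0 z : z.2 != 0 ->
  nu_density (chart0 z) * (z.2 ^+ 2)^-1 = mu_density z.
Proof.
move=> z0; rewrite /nu_density /mu_density -invfM -exprMn; congr (_ ^+ 2)^-1.
by rewrite /=; field.
Qed.

(** Here 1 + (x - 1)(1 - y) = x + y - xy, and the Jacobian is 1. *)
Lemma nu_density_chart1 z : nu_density (chart1 z) = mu_density z.
Proof.
by rewrite /nu_density /mu_density; congr (_ ^+ 2)^-1; rewrite /=; ring.
Qed.

(** For [S] in the strip 0 < y <= 1 this is the image of [S] under [chart0], written as a preimage
    so that its measurability is immediate. *)
Definition chart0_range S : set (T * T) :=
  ([set: T] `*` `[0, +oo[) `&` chart0V @^-1` S.

Lemma measurable_chart0_range S : measurable S -> measurable (chart0_range S).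
Proof.
move=> mS; apply: measurableI.
  by apply: measurableX => //; exact: measurable_itv.
by rewrite -[X in measurable X]setTI; exact: measurable_chart0V.
Qed.

Lemma integral_chart0 S B : measurable S -> measurable B ->
  S `<=` [set: T] `*` `]0, 1] ->
  (\int[@lebesgue2 K]_(p in B `&` chart0_range S) (nu_density p)%:E =
   \int[@lebesgue2 K]_(z in S `&` chart0 @^-1` B) (mu_density z)%:E)%E.
Proof.
move=> mS mB S01; have mQ := measurable_chart0_range S mS.
rewrite [LHS]integral_mkcond.
(* The integrand, cut off outside its domain, is integrated over the half-plane Y >= 0, the image of
   the strip 0 < y <= 1. *)
transitivity (\int[@lebesgue2 K]_(p in [set: T] `*` `[0%R, +oo[)
    ((EFin \o nu_density) \_ (B `&` chart0_range S)) p)%E.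
  rewrite [RHS]integral_mkcond; apply: eq_integral => p _.
  rewrite [RHS]patchE; case: ifPn => // pI; rewrite patchE ifN//.
  by apply: contra pI; rewrite !inE => -[_ []].
rewrite ge0_integral_lebesgue2_inv_shift; last 2 first.
- apply/(measurable_restrictT _ (measurableI _ _ mB mQ)).
  apply: measurable_funTS; apply/measurable_EFinP; exact: measurable_nu_density.
- by apply: erestrict_ge0 => p _; rewrite lee_fin nu_density_ge0.
rewrite integral_mkcond [RHS]integral_mkcond; apply: eq_integral => z _.
rewrite -/(chart0 z) !patchE.
case: ifPn => [|zI]; last first.
  by rewrite ifN//; apply: contra zI; rewrite !inE => -[/S01].
rewrite !inE => -[_ /=]; rewrite in_itv/= => /andP[z0 z1].
have -> : (chart0 z \in B `&` chart0_range S) = (z \in S `&` chart0 @^-1` B).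
  apply/idP/idP; rewrite !inE /= => -[].
    by move=> Bz [_ /=]; rewrite chart0K.
  move=> Sz Bz; split=> //; split=> /=; last by rewrite chart0K.
  by split=> //=; rewrite in_itv/= andbT subr_ge0 invf_ge1.
case: ifP => _; last by rewrite mul0e.
by rewrite -EFinM nu_density_chart0// gt_eqF.
Qed.

Lemma integral_chart1 S B : measurable S -> measurable B ->
  (\int[@lebesgue2 K]_(p in B `&` chart1V @^-1` S) (nu_density p)%:E =
   \int[@lebesgue2 K]_(z in S `&` chart1 @^-1` B) (mu_density z)%:E)%E.
Proof.
move=> mS mB.
have mQ : measurable (chart1V @^-1` S).
  by rewrite -[X in measurable X]setTI; exact: measurable_chart1V.
rewrite [LHS]integral_mkcond ge0_integral_lebesgue2_flip; last 2 first.
- apply/(measurable_restrictT _ (measurableI _ _ mB mQ)).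
  by apply: measurable_funTS; apply/measurable_EFinP; exact: measurable_nu_density.
- by apply: erestrict_ge0 => p _; rewrite lee_fin nu_density_ge0.
rewrite [RHS]integral_mkcond; apply: eq_integral => z _.
rewrite -/(chart1 z) !patchE.
have -> : (chart1 z \in B `&` chart1V @^-1` S) = (z \in S `&` chart1 @^-1` B).
  by apply/idP/idP; rewrite !inE /= chart1K => -[].
by case: ifP => // _; rewrite /= nu_density_chart1.
Qed.

End charts.

(** * The image measure and its density *)

Section invariant_density.
Variables (K : realType) (R : set (K * K)).
Local Notation T := (measurableTypeR K).
Hypotheses (ROmega : R `<=` @Omega K) (posR : forall z, R z -> 0 < z.2).
Hypothesis sR1 : forall z, R z -> s_ R z = 1.
Hypothesis mR : measurable (R : set (T * T)).

Definition R0_ : set (T * T) := R `&` [set z | u_ R z = 0].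
Definition R1_ : set (T * T) := R `\` [set z | u_ R z = 0].

Lemma measurable_R0_ : measurable R0_.
Proof. by apply: measurableI => //; exact: measurable_u_eq0. Qed.

Lemma measurable_R1_ : measurable R1_.
Proof. by apply: measurableD => //; exact: measurable_u_eq0. Qed.

Lemma phi_chart0 z : R0_ z -> phi_ R z = chart0 K z.
Proof.
move=> [Rz uz]; rewrite /phi_ uz eqxx /chart0 mulrBl mul1r divff//.
by rewrite gt_eqF// posR.
Qed.

Lemma phi_chart1 z : R1_ z -> phi_ R z = chart1 K z.
Proof. by move=> [Rz /eqP/negbTE uz]; rewrite /phi_ uz. Qed.

Lemma R0_sub : R0_ `<=` [set: T] `*` `]0, 1].
Proof.
move=> z [Rz _]; split=> //=; rewrite in_itv/= posR//=.
by have [_ /andP[]] := ROmega _ Rz.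
Qed.

(** Turning the image under [phi_] into preimages under the inverse charts gives its measurability
    and lets integrals be split. *)
Lemma Omega_E : Omega_ R = chart0_range K R0_ `|` chart1V K @^-1` R1_.
Proof.
apply/seteqP; split=> [_ [z Rz <-]|p].
  have [uz|uz] := pselect (u_ R z = 0).
    have Rz0 : R0_ z by [].
    left; rewrite phi_chart0//; split; last by rewrite /= chart0K.
    have [_ /=] := R0_sub _ Rz0; rewrite in_itv/= => /andP[z0 z1].
    by split=> //=; rewrite in_itv/= andbT subr_ge0 invf_ge1.
  have Rz1 : R1_ z by [].
  by right; rewrite phi_chart1//= chart1K.
case=> [[_ /= Rp]|/= Rp].
  by exists (chart0V K p); [case: Rp|rewrite phi_chart0// chart0VK].
by exists (chart1V K p); [case: Rp|rewrite phi_chart1// chart1VK].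
Qed.

Lemma measurable_Omega_ : measurable (Omega_ R : set (T * T)).
Proof.
rewrite Omega_E; apply: measurableU.
  by apply: measurable_chart0_range; exact: measurable_R0_.
rewrite -[X in measurable X]setTI; apply: measurable_chart1V => //.
exact: measurable_R1_.
Qed.

(** The sign of X separates them: X = x >= 0 on the first, and X = x - 1 < 0 on the second by
    [u_neq0]. *)
Lemma chart_ranges_disjoint :
  [disjoint chart0_range K R0_ & chart1V K @^-1` R1_].
Proof.
rewrite disj_set2E; apply/eqP/seteqP; split=> // p [[_ /= [Rp0 _]] [Rp1 /eqP u1]].
have [_ _] := u_neq0 _ _ ROmega posR sR1 _ Rp1 u1.
by have [/andP[+ _] _] := ROmega _ Rp0; rewrite /=; lra.
Qed.

Lemma integral_Omega_ (B : set (T * T)) : measurable B ->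
  (\int[@lebesgue2 K]_(p in B `&` Omega_ R) (nu_density K p)%:E =
   \int[@lebesgue2 K]_(z in phi_ R @^-1` B `&` R) (mu_density K z)%:E)%E.
Proof.
move=> mB.
have mR0 := measurable_R0_; have mR1 := measurable_R1_.
have m0 : measurable (R0_ `&` chart0 K @^-1` B).
  apply: measurableI => //; rewrite -[X in measurable X]setTI.
  exact: measurable_chart0.
have m1 : measurable (R1_ `&` chart1 K @^-1` B).
  apply: measurableI => //; rewrite -[X in measurable X]setTI.
  exact: measurable_chart1.
have -> : phi_ R @^-1` B `&` R =
    (R0_ `&` chart0 K @^-1` B) `|` (R1_ `&` chart1 K @^-1` B).
  apply/seteqP; split=> z.
    move=> [/= Bz Rz]; have [uz|uz] := pselect (u_ R z = 0).
      by left; split=> //=; rewrite -phi_chart0.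
    by right; split=> //=; rewrite -phi_chart1.
  case=> -[Rz /= Bz]; (split; last by case: Rz) => /=.
    by rewrite phi_chart0.
  by rewrite phi_chart1.
rewrite Omega_E setIUr ge0_integral_setU.
- rewrite [RHS]ge0_integral_setU//.
  + by rewrite integral_chart0 ?integral_chart1//; exact: R0_sub.
  + by apply: measurable_funTS; apply/measurable_EFinP; exact: measurable_mu_density.
  + by move=> z _; rewrite lee_fin mu_density_ge0.
  + rewrite disj_set2E; apply/eqP/seteqP; split=> // z.
    by move=> [[[_ u0] _] [[_]]].
- by apply: measurableI => //; exact: measurable_chart0_range.
- apply: measurableI => //; rewrite -[X in measurable X]setTI.
  exact: measurable_chart1V.
- by apply: measurable_funTS; apply/measurable_EFinP; exact: measurable_nu_density.
- by move=> z _; rewrite lee_fin nu_density_ge0.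
- move: chart_ranges_disjoint; rewrite !disj_set2E => /eqP H.
  by apply/eqP; rewrite setIACA H setI0.
Qed.

Lemma nubar_E (B : set (T * T)) : measurable B ->
  nubar_ R B = (\int[@lebesgue2 K]_(p in B `&` Omega_ R)
    ((fine (mubar R) * (1 + p.1 * p.2) ^+ 2)^-1)%:E)%E.
Proof.
move=> mB.
under [RHS]eq_integral do rewrite invfM EFinM -/(nu_density K _).
rewrite ge0_integralZl_EFin//.
- rewrite integral_Omega_// /nubar_ /pushforward /mubar_ /mubar.
  (* The cut-off by [Omega] in [mubar] disappears because [R] lies in [Omega]. *)
  rewrite (_ : _ `&` _ `&` @Omega K = phi_ R @^-1` B `&` R)//.
  by apply: setIidl => z [_ /ROmega].
- by apply: measurableI => //; exact: measurable_Omega_.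
- by move=> p _; rewrite lee_fin nu_density_ge0.
- by apply: measurable_funTS; apply/measurable_EFinP; exact: measurable_nu_density.
- rewrite invr_ge0 fine_ge0//; apply: integral_ge0 => z _.
  by rewrite lee_fin invr_ge0 exprn_even_ge0.
Qed.

End invariant_density.

(** The formula is asserted where the return time is finite; elsewhere [F_] is only a completion by
    the identity. *)
Theorem theorem6p16 (K : realType) (R : set (K * K))
    (indR : inducible R)
    (awayR : bounded_away_from_origin R)
    (posR : forall z, R z -> 0 < z.2)
    (sR1 : forall z, R z -> s_ R z = 1) :
  [/\ forall p, Omega_ R p -> Omega_ R (tau_ R p),
      forall Y : K, Omega_ R (0, Y) -> tau_ R (0, Y) = (0, Y),
      forall X Y : K, Omega_ R (X, Y) -> X != 0 ->
        let z := phiinv_ R (X, Y) in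
        N_ R z <> None ->
        tau_ R (X, Y) =
          (alpha_ R z / X - beta_ R z, 1 / (beta_ R z + alpha_ R z * Y)),
      measurable (Omega_ R)
    & forall B : set (K * K), measurable B ->
        nubar_ R B =
          (\int[@lebesgue2 K]_(p in B `&` Omega_ R)
             ((fine (mubar R) * (1 + p.1 * p.2) ^+ 2)^-1)%:E)%E].
Proof.
have [mR ROmega _] := indR; split.
- exact: tau_stable.
- by move=> Y _; rewrite /tau_ eqxx.
- exact: tauE.
- exact: measurable_Omega_.
- exact: nubar_E.
Qed.
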